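(* There exist infinitely many triples $(a,b,c)\in\mathbb{N}^3$ satisfying $a+b=c$, $\gcd(a,b,c)=1$ and $$c>H\exp\Bigl(\frac{2\log H}{\log\log H}\Bigr),$$ where $H=\max(H(abc),e^{e})$.
   Context: $\mathbb{N}$ denotes the positive integers and $\log$ the natural logarithm. For $n\in\mathbb{N}$, $\omega(n)$ is the number of distinct prime divisors of $n$ and $\gamma(n):=\prod_{p\mid n}p$ is the product of the distinct primes dividing $n$ (so $\gamma(1)=1$). The function $H(\cdot)$ is defined by $$H(n):=\frac{\gamma(n)}{(\log\gamma(n))^{\omega(n)}}\qquad(n\in\mathbb{N}),$$ with the convention $0^0=1$, so that $H(1)=1$. *)

(* Defs.v *)
From HB Require Import structures.
From mathcomp Require Import all_boot all_order all_algebra.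
From mathcomp Require Import boolp classical_sets cardinality reals sequences exp.
Set Implicit Arguments.
Unset Strict Implicit.
Unset Printing Implicit Defensive.
Import Order.TTheory GRing.Theory Num.Theory.
Local Open Scope ring_scope.

Definition omega (n : nat) : nat := size (primes n).

Definition radical (n : nat) : nat := (\prod_(p <- primes n) p)%N.

(* As [0 ^+ 0 = 1], the convention 0^0 = 1 is built in and [H R 1 = 1].
   Only [n > 0] is meaningful; [primes 0 = [::]] makes [H R 0 = 1] too. *)
Definition H (R : realType) (n : nat) : R :=
  (radical n)%:R / ln (radical n)%:R ^+ omega n.

(* The lower bound e^e keeps ln (ln _) at least 1. *)
Definition Htrunc (R : realType) (n : nat) : R :=
  Num.max (H R n) (expR (expR 1)).

(* Main.v *)
(* Take a prime y with pi(y) >= 0.99 y / log y; such y are arbitrarily large, since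
   otherwise the sum of log p / (p - 1) over p <= n would be too small for Stirling's
   lower bound on n!. Let S be the set of primes in [8, y]. Among the 2^|S| products
   of subsets of S, two with equally many factors are congruent modulo 2^(k+1) as soon
   as 2^(k+1) (|S| + 1) < 2^|S|; without their common factors they become coprime b < c
   with m prime factors each, and a = c - b is divisible by 2^(k+1). With K = k log 2
   this gives log gamma(abc) <= log b + 2 log c - K and omega(abc) >= 2m. As log c may
   be replaced by its upper bound m log y, optimising over m shows that log c exceeds
   log H(abc) by more than 2 (m log y) / log (m log y) provided that
   K >= (2/3 + eps) y / log y. This is possible because K is about
   0.99 (log 2) y / log y and log 2 > 2/3. *)
Require Import Defs.
From HB Require Import structures.
From mathcomp Require Import all_boot all_order all_algebra.
From mathcomp Require Import boolp classical_sets cardinality reals sequences exp.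
From mathcomp Require Import ring lra zify.
Set Implicit Arguments.
Unset Strict Implicit.
Unset Printing Implicit Defensive.
Import Order.TTheory GRing.Theory Num.Theory.
Local Open Scope ring_scope.

(** * Elementary inequalities for the logarithm *)

Lemma ln_le_sub1 (R : realType) (x : R) : 0 < x -> ln x <= x - 1.
Proof.
move=> x0; have := @le_ln1Dx R (x - 1); rewrite (_ : 1 + (x - 1) = x); last by ring.
by apply; lra.
Qed.

Lemma ln_ge_1subV (R : realType) (x : R) : 0 < x -> 1 - x^-1 <= ln x.
Proof.
move=> x0; have := @ln_le_sub1 R x^-1; rewrite invr_gt0 => /(_ x0).
by rewrite lnV ?posrE//; lra.
Qed.

Lemma ln_le_tangent (R : realType) (t x : R) :
  0 < t -> 0 < x -> ln x <= ln t + (x - t) / t.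
Proof.
move=> t0 x0; have xt0 : 0 < x / t by rewrite divr_gt0.
have := ln_le_sub1 xt0; rewrite ln_div ?posrE//.
by rewrite mulrBl divff ?gt_eqF//; lra.
Qed.

(** With y = x (1 + d), the tangent at x gives ln y <= ln x + d <= (1 + d) ln x, because ln x >=
    1. *)
Lemma div_ln_nondecreasing (R : realType) (x y : R) :
  1 <= ln x -> 0 < x -> x <= y -> x / ln x <= y / ln y.
Proof.
move=> lx1 x0 xy; have y0 : 0 < y by lra.
have lxy : ln x <= ln y by rewrite ler_ln.
have := ln_le_tangent x0 y0; set d := (y - x) / x => lyd.
have yE : y = x * (1 + d) by rewrite /d; field; rewrite gt_eqF.
have d0 : 0 <= d by rewrite /d divr_ge0//; lra.
rewrite ler_pdivrMr; last by lra.
rewrite mulrAC ler_pdivlMr; last by lra.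
rewrite [X in _ <= X * _]yE -mulrA ler_pM2l//; nra.
Qed.

(** Follows from 2 (99/100)^68 > 1 and ln (99/100) <= -1/100. *)
Lemma ln2_gt (R : realType) : 68 / 100 < ln 2 :> R.
Proof.
have h0 : (0 : R) < (99 / 100) ^+ 68 by rewrite exprn_gt0//; lra.
have : ln ((2 : R) * (99 / 100) ^+ 68) > 0.
  apply: ln_gt0; rewrite expr_div_n mulrA ltr_pdivlMr ?mul1r.
    by rewrite -!natrX -natrM ltr_nat; lia.
  by rewrite exprn_gt0.
rewrite lnM ?posrE// lnXn; last by lra.
have := @ln_le_sub1 R (99 / 100) ltac:(lra).
by rewrite -[_ *+ 68]mulr_natr; lra.
Qed.

(* In the application [m] is the number of primes in each of b and c, [u = ln b],
   [v = ln c] and [G = ln (radical (a * b * c))]. The loss [G - 2m ln G] is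
   increasing in [G], and with [v] replaced by its upper bound [m ln y] it is at
   most its value at [3 m ln y - K]; bounding [ln (3 m ln y)] below by
   [1 - 1/z <= ln z] at [z = 3 m ln y / (1.005 y)] removes [m]. The constant
   67/100 only has to exceed 2/3: then [1 + ln (3/2 * 67/100) > 1]. *)
Lemma log_saving (R : realType) (y K m u v G : R) :
  let l := ln y in
  0 < y -> 1 < l -> 1 < K -> 0 < m -> 
  67 / 100 * y <= K * (l - 1) ->
  l < 1004 / 1000 * ln K ->
  u <= v -> v <= m * l -> K <= v ->
  4 * m <= G -> G <= u + 2 * v - K ->
  G - 2 * m * ln G < v - 2 * (m * l) / ln (m * l).
Proof.
move=> l y0 l1 K1 m0 hK hl uv vml Kv G4 GuvK.
set q := m * l in vml *; pose g := 3 * q - K.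
have q0 : 0 < q by rewrite mulr_gt0//; lra.
have G0 : 0 < G by lra.
have g0 : 0 < g by rewrite /g; lra.
(* As [4 * m <= G], the left side is at most half of [g - G]; the other half covers [q - v] because
   [g - G >= 3 * (q - v)]. *)
have lg : 2 * m * (ln g - ln G) <= g - G - (q - v).
  have := ln_le_tangent G0 g0; set d := (g - G) / G => ld.
  have dE : g - G = d * G by rewrite /d; field; rewrite gt_eqF.
  have d0 : 0 <= d by rewrite /d divr_ge0//; rewrite /g; lra.
  have : 4 * m * d <= g - G by rewrite [leRHS]dE mulrC ler_wpM2l.
  have : 2 * m * (ln g - ln G) <= 2 * m * d by rewrite ler_pM2l//; lra.
  rewrite /g; lra.
have lg3 : ln (3 * q) - K / (2 * q) <= ln g.
  have := ln_le_tangent g0 (_ : 0 < 3 * q).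
  rewrite (_ : 3 * q - g = K); last by rewrite /g; lra.
  have : K / g <= K / (2 * q).
    rewrite ler_pM2l ?lef_pV2 ?posrE//; [rewrite /g; lra|lra|lra].
  move=> ? /(_ ltac:(lra)); lra.
(* The 4/1000 above 1 comes from ln (1005/1000) and pays for the factor 1004/1000 in [lq2]. *)
have lq : 1004 / 1000 + l - 67 / 100 * y / (2 * q) <= ln (3 * q).
  pose t := 1005 / 1000 * y.
  have t0 : 0 < t by rewrite /t; lra.
  have : ln (t / (3 * q)) <= t / (3 * q) - 1.
    by apply: ln_le_sub1; rewrite divr_gt0//; lra.
  rewrite ln_div ?posrE; [|lra|lra].
  rewrite {1}/t [X in X - _]lnM ?posrE; [|lra|lra].
  have := @ln_ge_1subV R (1005 / 1000) ltac:(lra).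
  have -> : t / (3 * q) = 67 / 100 * y / (2 * q).
    by rewrite /t; field; rewrite gt_eqF.
  rewrite invf_div -/l; lra.
have lKq : ln K <= ln q by rewrite ler_ln ?posrE//; lra.
have lq2 : 2 * q / ln q < 2 * m * (1004 / 1000).
  rewrite ltr_pdivrMr; last by lra.
  rewrite /q; have : m * l < m * (1004 / 1000 * ln (m * l)).
    by rewrite ltr_pM2l//; rewrite -/q; lra.
  lra.
set e := 67 / 100 * y / (2 * q) + K / (2 * q).
(* Since 2 m e = (67/100 y + K) / l, this is exactly [hK]. *)
have key : 2 * m * e <= K.
  rewrite /e -mulrDl mulrA ler_pdivrMr; last lra.
  rewrite /q; nra.
have main : 2 * m * (1004 / 1000 + l - e) <= 2 * m * ln g.
  by rewrite ler_pM2l /e; lra.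
have qE : m * l = q by [].
have gE : g = 3 * q - K by [].
move: lg lq2 key main qE gE; clear; clearbody g q e l; set r := 2 * q / _.
by move=> *; lra.
Qed.

(** * Many primes below suitable y, from the size of n! *)

Definition prime_count (n : nat) : nat := \sum_(0 <= p < n.+1 | prime p) 1.

Lemma prime_countS n : prime_count n.+1 = (prime_count n + prime n.+1)%N.
Proof.
rewrite /prime_count big_mkcond big_nat_recr //= -big_mkcond.
by case: prime.
Qed.

Lemma prime_count_le n : (prime_count n <= n)%N.
Proof.
elim: n => [|n IH]; first by rewrite /prime_count big_mkcond big_nat1.
by rewrite prime_countS; case: prime => /=; lia.
Qed.

Lemma prime_count_gt0 n : (1 < n)%N -> (0 < prime_count n)%N.
Proof.
elim: n => [//|[//|n] IH _]; case: n IH => [_|n /(_ isT)]; last first.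
  by rewrite (prime_countS n.+2); lia.
by rewrite prime_countS /=; lia.
Qed.

Lemma prime_dvd_fact p n : prime p -> (p %| n`!)%N = (p <= n)%N.
Proof.
move=> pp; apply/idP/idP => [|pn]; last by rewrite dvdn_fact// prime_gt0.
elim: n => [|n IH]; first by rewrite fact0 Euclid_dvd1.
by rewrite factS Euclid_dvdM// => /orP[/dvdn_leq|/IH]; lia.
Qed.

(** Legendre's formula; keeping the remainder [n %/ p ^ j] beside the partial sum makes the
    induction telescope. *)
Lemma logn_fact_le p n : prime p -> (p.-1 * logn p n`! <= n)%N.
Proof.
move=> pp; rewrite logn_fact//.
suff : forall j, (p.-1 * (\sum_(1 <= k < j.+1) n %/ p ^ k) + n %/ p ^ j <= n)%N.
  by move=> /(_ n); apply: leq_trans; rewrite leq_addr.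
elim=> [|j IH]; first by rewrite big_geq// muln0 expn0 divn1.
rewrite big_nat_recr//= expnSr divnMA mulnDr.
have := leq_divM (n %/ p ^ j) p; have := prime_gt1 pp.
move: IH; set s := (_ * _)%N; set t := (n %/ p ^ j)%N; set d := (t %/ p)%N.
by case: p pp @s @t @d => [//|p] _ s t d /=; lia.
Qed.

Lemma ln_natprod (R : realType) (s : seq nat) (F : nat -> nat) :
  (forall i, i \in s -> (0 < F i)%N) ->
  ln (\prod_(i <- s) F i)%N%:R = \sum_(i <- s) ln (F i)%:R :> R.
Proof.
elim: s => [|i s IH] F0; first by rewrite !big_nil ln1.
have Fs j : j \in s -> (0 < F j)%N by move=> js; apply: F0; rewrite inE js orbT.
rewrite !big_cons natrM lnM ?posrE ?ltr0n ?IH//; first by rewrite F0// mem_head.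
by rewrite big_seq prodn_cond_gt0.
Qed.

Lemma ln_fact_ge (R : realType) (n : nat) :
  n%:R * ln n%:R - n%:R <= ln n`!%:R :> R.
Proof.
elim: n => [|n IH]; first by rewrite fact0 ln1; lra.
have n1 : 0 < n.+1%:R :> R by rewrite ltr0n.
rewrite factS natrM lnM ?posrE ?ltr0n ?fact_gt0//.
have [->|n0] := posnP n; first by rewrite fact0 ln1; lra.
have n0' : 0 < n%:R :> R by rewrite ltr0n.
have := ln_le_tangent n0' n1; rewrite -natr1 addrAC subrr add0r div1r => h.
have : n%:R * ln (n%:R + 1) <= n%:R * (ln n%:R + n%:R^-1) :> R by rewrite ler_pM2l.
rewrite mulrDr divff ?gt_eqF//; lra.
Qed.

(** Stirling's bound divided by n, once ln n! is expanded over primes and each exponent is bounded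
    by n / (p - 1). *)
Lemma sum_ln_prime_ge (R : realType) (n : nat) : (0 < n)%N ->
  ln n%:R - 1 <= \sum_(0 <= p < n.+1 | prime p) (ln p%:R / (p%:R - 1)) :> R.
Proof.
move=> n0; have n0' : 0 < n%:R :> R by rewrite ltr0n.
rewrite -(ler_pM2l n0') mulrBr mulr1; apply: le_trans (ln_fact_ge R n) _.
rewrite [in leLHS](prod_prime_decomp (fact_gt0 n)) prime_decompE big_map /=.
rewrite ln_natprod => [|p]; last first.
  by rewrite mem_primes expn_gt0 => /andP[/prime_gt0->].
have -> : \sum_(p <- primes n`!) ln (p ^ logn p n`!)%N%:R =
          \sum_(0 <= p < n.+1 | prime p) ln (p ^ logn p n`!)%N%:R :> R.
  rewrite -[RHS]big_filter; apply: perm_big; apply: uniq_perm.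
  - exact: primes_uniq.
  - by rewrite filter_uniq// iota_uniq.
  move=> p; rewrite mem_primes mem_filter mem_index_iota fact_gt0 /= ltnS.
  by have [pp|//] := boolP (prime p); rewrite prime_dvd_fact.
rewrite mulr_sumr; apply: ler_sum => p pp.
have p1 : 0 < p%:R - 1 :> R by rewrite subr_gt0 ltr1n prime_gt1.
rewrite mulrA ler_pdivlMr// natrX lnXn ?ltr0n ?prime_gt0//.
rewrite -[_ *+ logn _ _]mulr_natr -mulrA [leRHS]mulrC ler_wpM2l ?ln_ge0 ?ler1n ?prime_gt0//.
have := logn_fact_le n pp; rewrite -(ler_nat R) natrM -subn1 natrB ?prime_gt0//.
by rewrite mulrC.
Qed.

(* If the bound failed for all large primes, ln p / (p - 1) would be at most
   eta / pi(p) for some eta < 1, so its sum over p <= n would be at most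
   eta * ln n + O(1), contradicting [sum_ln_prime_ge]. *)
Lemma prime_count_ge (R : realType) (delta : R) (Q : nat) :
  0 < delta -> delta < 1 ->
  exists y : nat, [/\ (Q <= y)%N, prime y &
    delta * y%:R <= (prime_count y)%:R * ln y%:R].
Proof.
move=> d0 d1; apply: contrapT => nex.
pose eta := (1 + delta) / 2.
(* For p >= [N0] one has delta p < eta (p - 1), so a failed bound at p yields ln p / (p - 1) <= eta
   / pi(p). *)
have [N0 hN0] : exists N0 : nat, eta / (eta - delta) < N0%:R.
  exists (Num.trunc (eta / (eta - delta))).+1.
  by rewrite truncnS_gt.
pose M := (maxn 2 (maxn Q N0)).
pose f n : R := \sum_(0 <= p < n.+1 | prime p) (ln p%:R / (p%:R - 1)).
have fS n : f n.+1 = f n + (if prime n.+1 then ln n.+1%:R / (n.+1%:R - 1) else 0).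
  by rewrite /f big_mkcond big_nat_recr //= -big_mkcond.
have ub j : f (M + j)%N <= f M + eta * ln (prime_count (M + j))%:R.
  elim: j => [|j IH].
    rewrite addn0 lerDl mulr_ge0//; first by rewrite /eta; lra.
    by rewrite ln_ge0// ler1n prime_count_gt0// leq_maxl.
  rewrite addnS fS prime_countS.
  case: ifP => pp /=; last by rewrite addr0 addn0.
  set p := (M + j).+1 in pp *; set c := prime_count (M + j) in IH *.
  have hp : ~ (delta * p%:R <= (prime_count p)%:R * ln p%:R).
    by move=> h; apply: nex; exists p; split=> //; rewrite /p /M; lia.
  have cp : prime_count p = (c + 1)%N by rewrite /p prime_countS pp.
  have c0 : 0 < c%:R :> R by rewrite ltr0n prime_count_gt0// /M; lia.
  have pN : N0%:R <= p%:R :> R by rewrite ler_nat /p /M; lia.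
  have p2 : 2 <= p%:R :> R by rewrite ler_nat /p /M; lia.
  have : ln p%:R / (p%:R - 1) <= eta / (c%:R + 1).
    rewrite ler_pdivrMr; last by lra.
    rewrite mulrAC ler_pdivlMr; last by lra.
    move: hp => /negP; rewrite -ltNge cp natrD.
    have : eta < p%:R * (eta - delta).
      by rewrite -ltr_pdivrMr; [lra | rewrite /eta; lra].
    by move=> ? ?; rewrite mulrC; lra.
  (* Each new prime thus adds at most the increment of eta ln pi, and the sum telescopes. *)
  have : (c%:R + 1)^-1 <= ln (c%:R + 1) - ln c%:R :> R.
    have := @ln_ge_1subV R ((c%:R + 1) / c%:R) ltac:(rewrite divr_gt0//; lra).
    rewrite ln_div ?posrE//; last by lra.
    rewrite invf_div; have -> : c%:R / (c%:R + 1) = 1 - (c%:R + 1)^-1 :> R.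
      by field; lra.
    by lra.
  rewrite natrD => h1 h2.
  have : eta / (c%:R + 1) <= eta * (ln (c%:R + 1) - ln c%:R).
    by rewrite ler_wpM2l// /eta; lra.
  by lra.
(* Once ln n > [B], the lower bound ln n - 1 exceeds f(M) + eta ln n. *)
pose B := (f M + 1) / (1 - eta).
have [j hj] : exists j : nat, expR B < (M + j)%:R.
  exists (Num.trunc (expR B)).+1; rewrite natrD.
  by have := truncnS_gt (expR B); have := ler0n R M; lra.
have Mj0 : (0 < M + j)%N by rewrite /M; lia.
have := sum_ln_prime_ge R Mj0; rewrite -/(f _) => lb.
have : ln (prime_count (M + j))%:R <= ln (M + j)%:R :> R.
  rewrite ler_ln ?posrE ?ltr0n ?ler_nat ?prime_count_le//.
  by rewrite prime_count_gt0// /M; lia.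
have : B < ln (M + j)%:R.
  by rewrite -[ltLHS]expRK ltr_ln ?posrE ?expR_gt0 ?ltr0n.
rewrite ltr_pdivrMr; last by rewrite /eta; lra.
move=> h1 h2; have : eta * ln (prime_count (M + j))%:R <= eta * ln (M + j)%:R.
  by rewrite ler_wpM2l// /eta; lra.
by have := ub j; lra.
Qed.

(** * Radicals, and coprime pairs from colliding products *)

Lemma radical_dvd (n : nat) : (0 < n)%N -> (radical n %| n)%N.
Proof.
move=> n0; rewrite [X in (_ %| X)%N](prod_prime_decomp n0) prime_decompE big_map.
rewrite /radical big_seq [X in (_ %| X)%N]big_seq.
elim/big_ind2: _ => // [a b c d ab cd|p]; first exact: dvdn_mul.
by move=> /= pn; rewrite dvdn_exp// logn_gt0.
Qed.

(** Replacing p^k by p in n = m p^k keeps the prime divisors, so the radical divides m p; one factor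
    p remains, hence [k.-1]. *)
Lemma radical_pow_mul_le (p k n : nat) :
  (0 < k)%N -> (0 < n)%N -> (p ^ k %| n)%N -> (p ^ k.-1 * radical n <= n)%N.
Proof.
case: k => [//|k] _ n0 /dvdnP[m nE].
move: n0; rewrite nE muln_gt0 expn_gt0 orbF => /andP[m0 p0].
have -> : radical (m * p ^ k.+1) = radical (m * p).
  rewrite /radical; congr (\prod_(i <- _) i)%N; apply/eq_primes => q.
  by rewrite !primesM ?expn_gt0 ?p0// primesX.
rewrite expnS mulnA (mulnC (p ^ _)%N) leq_mul// dvdn_leq ?muln_gt0 ?m0//.
by rewrite radical_dvd// muln_gt0 m0.
Qed.

Lemma prod_le_radical (s : seq nat) (n : nat) :
  uniq s -> {subset s <= primes n} -> (\prod_(p <- s) p <= radical n)%N.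
Proof.
move=> us sn; have -> : radical n = (\prod_(p <- primes n | p \in s) p *
    \prod_(p <- primes n | p \notin s) p)%N by rewrite /radical (bigID (mem s)) /=.
have -> : (\prod_(p <- s) p = \prod_(p <- primes n | p \in s) p)%N.
  rewrite -[RHS]big_filter; apply: perm_big; apply: uniq_perm => //.
    by rewrite filter_uniq// primes_uniq.
  by move=> p; rewrite mem_filter; case: (boolP (p \in s)) => // /sn ->.
rewrite leq_pmulr// big_seq_cond prodn_cond_gt0// => p /andP[].
by rewrite mem_primes => /andP[/prime_gt0].
Qed.

(* Pigeonhole on the pairs (cardinal, product mod 2 ^ k) of the subsets of [S],
   after which the common elements of two colliding subsets are removed. *)
Lemma odd_prod_collision (I : finType) (F : I -> nat) (S : {set I}) (k : nat) :
  {in S, forall i, odd (F i)} -> (2 ^ k * #|S|.+1 < 2 ^ #|S|)%N ->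
  exists A B : {set I}, [/\ (A \subset S) && (B \subset S), [disjoint A & B],
    #|A| = #|B|, (0 < #|A|)%N & (\prod_(i in A) F i == \prod_(i in B) F i %[mod 2 ^ k])%N].
Proof.
move=> oddF kS; have k0 : (0 < 2 ^ k)%N by rewrite expn_gt0.
pose g (A : {set I}) : 'I_(#|S|.+1) * 'I_(2 ^ k) :=
  (inord #|A|, Ordinal (ltn_pmod (\prod_(i in A) F i) k0)).
have /dinjectivePn[A AS [B]] : ~~ dinjectiveb g (mem (powerset S)).
  apply/negP => /dinjectiveP ginj.
  have := max_card (mem (g @: powerset S)).
  by rewrite card_in_imset// card_powerset card_prod !card_ord mulnC leqNgt kS.
rewrite !inE in AS *; move=> /andP[BA BS] [].
move=> /(congr1 val); rewrite /= !inordK ?ltnS ?subset_leq_card// => cAB pAB.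
exists (A :\: B), (B :\: A); split.
- by rewrite !(fintype.subset_trans (finset.subsetDl _ _)).
- rewrite -finset.setI_eq0; apply/eqP/finset.setP => x; rewrite !inE.
  by case: (x \in A); case: (x \in B).
- by rewrite !cardsD cAB finset.setIC.
- rewrite card_gt0 finset.setD_eq0; apply: contra BA => AB.
  by rewrite eq_sym eqEcard AB cAB leqnn.
have codd (D : {set I}) : D \subset S -> coprime (2 ^ k) (\prod_(i in D) F i).
  move=> /fintype.subsetP DS; rewrite coprimeXl// coprime2n.
  elim/big_ind: _ => // [x y ox oy|i /DS/oddF//]; by rewrite oddM ox.
(* The common product is odd, hence cancellable modulo 2^k. *)
have cI : coprime (2 ^ k) (\prod_(i in A :&: B) F i).
  by rewrite codd// (fintype.subset_trans (finset.subsetIl _ _)).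
move: pAB => /eqP; rewrite (big_setID B) [X in _ == X %[mod _]](big_setID A) /=.
rewrite [B :&: A]finset.setIC; set d := (\prod_(i in A :&: B) F i)%N in cI *.
set a := (\prod_(i in A :\: B) F i)%N; set b := (\prod_(i in B :\: A) F i)%N.
wlog ab : a b / (a <= b)%N => [hw|].
  case: (leqP a b) => [/hw//|/ltnW /hw h]; rewrite eq_sym => /h.
  by rewrite eq_sym.
rewrite eq_sym eqn_mod_dvd ?leq_mul2l ?ab ?orbT// -mulnBr Gauss_dvdr//.
by rewrite eq_sym eqn_mod_dvd.
Qed.

(** The 2m primes of b and c are distinct and all divide n. Requiring them to be at least 8 later
    gives ln (radical n) >= 6 m ln 2 >= 4 m. *)
Lemma exists_coprime_pair (y k : nat) (S : {set 'I_y.+1}) :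
  {in S, forall p : 'I_y.+1, prime p && (8 <= p)%N} ->
  (2 ^ k * #|S|.+1 < 2 ^ #|S|)%N ->
  exists m b c : nat, let n := ((c - b) * b * c)%N in
    [/\ (0 < m)%N, (0 < b < c)%N, coprime b c & (c <= y ^ m)%N] /\
    [/\ (2 ^ k %| c - b)%N, (2 * m <= omega n)%N & (8 ^ (2 * m) <= radical n)%N].
Proof.
move=> hS kS.
have oddS : {in S, forall p : 'I_y.+1, odd p}.
  by move=> p /hS /andP[/even_prime[->|//]].
have [A [B]] := odd_prod_collision oddS kS.
wlog : A B / (\prod_(p in A) p <= \prod_(p in B) p)%N.
  move=> hw [/andP[AS BS] dAB cAB A0 pAB].
  case: (leqP (\prod_(p in A) p) (\prod_(p in B) p)) => [le|/ltnW le].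
    by apply: (hw A B) => //; split=> //; rewrite AS.
  by apply: (hw B A) => //; rewrite disjoint_sym -cAB eq_sym AS BS.
set b := (\prod_(p in A) p)%N; set c := (\prod_(p in B) p)%N.
move=> bc [/andP[AS BS] dAB cAB A0 pAB].
have pS (D : {set 'I_y.+1}) (p : 'I_y.+1) : D \subset S -> p \in D -> prime p.
  by move=> /fintype.subsetP/[apply] /hS /andP[].
have cobc : coprime b c.
  rewrite /b; elim/big_rec: _ => [|p z pA IH]; first by rewrite coprime1n.
  rewrite coprimeMl IH andbT /c.
  elim/big_rec: _ => [|q w qB IH']; first by rewrite coprimen1.
  rewrite coprimeMr IH' andbT prime_coprime ?(pS _ _ AS pA)//.
  rewrite dvdn_prime2 ?(pS _ _ AS pA) ?(pS _ _ BS qB)//.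
  by apply: contraL qB => /eqP/val_inj <-; rewrite (disjointFr dAB pA).
have gt0 (D : {set 'I_y.+1}) : D \subset S -> (0 < \prod_(p in D) p)%N.
  by move=> DS; apply: prodn_cond_gt0 => r rD; exact: prime_gt0 (pS _ _ DS rD).
have b0 : (0 < b)%N by exact: gt0.
have c0 : (0 < c)%N by exact: gt0.
have b1 : (1 < b)%N.
  have [p pA] := card_gt0P A0.
  rewrite /b (bigD1 p)//= (leq_trans (prime_gt1 (pS _ _ AS pA)))// leq_pmulr//.
  by apply: prodn_cond_gt0 => q /andP[qA _]; exact: prime_gt0 (pS _ _ AS qA).
have ltbc : (b < c)%N.
  rewrite ltn_neqAle bc andbT; apply/eqP => bcE.
  by move: cobc; rewrite -bcE /coprime gcdnn => /eqP b1'; rewrite b1' in b1.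
pose s := [seq val p | p in A :|: B].
have us : uniq s by rewrite map_inj_uniq ?enum_uniq//; exact: val_inj.
have sn : {subset s <= primes ((c - b) * b * c)}.
  move=> r /fintype.imageP[p pAB' ->{r}].
  rewrite primesM ?muln_gt0 ?subn_gt0 ?ltbc// primesM ?subn_gt0//.
  rewrite !mem_primes b0 c0 /=; move: pAB'; rewrite inE => /orP[pA|pB].
    have pb : (p %| b)%N by rewrite /b (bigD1 p)//= dvdn_mulr.
    by rewrite (pS _ _ AS pA) pb orbT.
  have pc : (p %| c)%N by rewrite /c (bigD1 p)//= dvdn_mulr.
  by rewrite (pS _ _ BS pB) pc orbT.
have ss : size s = (2 * #|A|)%N.
  rewrite size_image cardsU; rewrite (disjoint_setI0 dAB).
  by rewrite cards0 subn0 -cAB mul2n addnn.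
exists #|A|, b, c; split; split=> //.
- by rewrite b0.
- rewrite cAB -prod_nat_const leq_prod// => p _; by rewrite -ltnS ltn_ord.
- by rewrite -eqn_mod_dvd// eq_sym.
- by rewrite -ss uniq_leq_size.
apply: leq_trans (prod_le_radical us sn); rewrite -ss big_image/=.
rewrite size_image -prod_nat_const leq_prod// => p.
by rewrite inE => /orP[/(fintype.subsetP AS)|/(fintype.subsetP BS)] /hS /andP[].
Qed.

(** * Choice of y, k and the set of primes *)

(** A thousandth of the exponent N pays for the factor N + 1 in the pigeonhole condition. *)
Lemma lt_exp2_div1000 (N : nat) : (20000 <= N)%N -> (N + 1 < 2 ^ (N %/ 1000))%N.
Proof.
suff h j : (20 <= j)%N -> (1000 * j.+1 + 1 < 2 ^ j)%N.
  move=> N20; apply: leq_trans (h _ _); last by rewrite leq_divRL.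
  by have := divn_eq N 1000; have := ltn_pmod N (isT : (0 < 1000)%N); lia.
elim: j => [//|j IH]; rewrite leq_eqVlt => /orP[/eqP <-//|].
by rewrite ltnS expnS => /IH; lia.
Qed.

(** Squaring exp(l/2) >= l/2 gives y >= l^2/4 for l = ln y. *)
Lemma prime_count_ln_ge (R : realType) (y P : R) :
  0 < y -> 0 < ln y -> 99 / 100 * y <= P * ln y -> 24 / 100 * ln y <= P.
Proof.
move=> y0; move lE : (ln y) => l l0 dens.
have : l * l / 4 <= y.
  have -> : y = expR (l / 2) ^+ 2.
    by rewrite -expRM_natl -[LHS]lnK ?posrE//; congr expR; rewrite lE; field.
  have -> : l * l / 4 = (l / 2) ^+ 2 by field.
  rewrite ler_sqr ?nnegrE ?expR_ge0//; last by lra.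
  by have := expR_ge1Dx (l / 2); lra.
by move=> ly; rewrite -(ler_pM2r l0); nra.
Qed.

(** 679/1000 is just below (999/1000)(68/100), where 68/100 bounds ln 2, and its product with 99/100
    still exceeds 67/100. *)
Lemma density_estimates (R : realType) (y P K : R) :
  0 < y -> 10 ^+ 5 <= ln y -> 99 / 100 * y <= P * ln y ->
  679 / 1000 * P - 7 <= K ->
  [/\ ln y / 10 <= K, 67 / 100 * y <= K * (ln y - 1) &
      ln y < 1004 / 1000 * ln K].
Proof.
move=> y0 l5 dens; have PL := prime_count_ln_ge y0 (_ : 0 < ln y) dens.
move: l5 dens PL; move lE : (ln y) => l l5 dens /(_ ltac:(lra)) PL KP.
have l0 : 0 < l by lra.
have K0 : 0 < K by lra.
have Kl : 67 / 100 * y <= K * (l - 1).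
  (* Bounds P l below by linear terms, so that its small surplus absorbs the terms in P and l
     alone. *)
  have h1 : 0 <= (l - 10 ^+ 5) * (P - 10 ^+ 4) by rewrite mulr_ge0//; lra.
  have : (679 / 1000 * P - 7) * (l - 1) <= K * (l - 1).
    by rewrite ler_pM2r//; lra.
  by move: dens h1 l5 PL; clear; lra.
split=> //; first by lra.
have : ln (67 / 100 * y) <= ln (K * l).
  have Kl0 : 0 < K * l by rewrite mulr_gt0.
  have : 67 / 100 * y <= K * l by lra.
  by move=> ?; rewrite ler_ln ?posrE// mulr_gt0//; lra.
rewrite [ln (K * l)]lnM ?posrE// lnM ?posrE//; last by lra.
have := @ln_ge_1subV R (67 / 100) ltac:(lra).
(* The tangent at 1024 gives ln l <= 9 + l/1024, which fits into the margin (4/1000) ln K since l >=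
   10^5. *)
have t0 : 0 < 1024 :> R by lra.
have := ln_le_tangent t0 l0.
have : ln 1024 <= 10 * (2 - 1) :> R.
  have -> : 1024 = 2 ^+ 10 :> R by rewrite -natrX.
  rewrite lnXn// -[_ *+ 10]mulr_natl ler_pM2l; last by lra.
  by apply: ln_le_sub1; lra.
rewrite invf_div lE; move: l5; clear; lra.
Qed.

Lemma exists_parameters (R : realType) (T : R) :
  exists (y k : nat) (S : {set 'I_y.+1}), let l : R := ln y%:R in
    let K : R := k%:R * ln 2 in
    [/\ {in S, forall p : 'I_y.+1, prime p && (8 <= p)%N},
        (2 ^ k.+1 * #|S|.+1 < 2 ^ #|S|)%N, (0 < y)%N & 1 < l] /\
    [/\ T <= K, 67 / 100 * y%:R <= K * (l - 1) &
        l < 1004 / 1000 * ln K].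
Proof.
(* 10^5 serves [density_estimates]; 10 |T| gives T <= l/10 <= K. *)
pose L : R := 10 ^+ 5 + 10 * `|T|.
have T0 := normr_ge0 T; have leT := ler_norm T.
have [y [Ly _ dens]] := @prime_count_ge R (99 / 100)
  (Num.trunc (expR L)).+1 ltac:(lra) ltac:(lra).
have y0 : (0 < y)%N by exact: leq_trans Ly.
have y0' : 0 < y%:R :> R by rewrite ltr0n.
pose l : R := ln y%:R.
have Ll : L <= l.
  rewrite -[leLHS]expRK ler_ln ?posrE ?expR_gt0//.
  by apply: le_trans (ltW (truncnS_gt _)) _; rewrite ler_nat.
pose S := [set p : 'I_y.+1 | prime p & (8 <= p)%N].
have cardS : (prime_count y <= #|S| + 8)%N.
  have -> : #|S| = (\sum_(0 <= p < y.+1 | prime p && (8 <= p)) 1)%N.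
    by rewrite big_mkord -sum1_card; apply: eq_bigl => p; rewrite inE.
  elim: (y) => [|j IH]; first by rewrite /prime_count big_mkcond big_nat1.
  rewrite prime_countS big_mkcond big_nat_recr//= -big_mkcond /=.
  have [j7|j7] := ltnP 7 j.+1; first by rewrite andbT; case: prime; lia.
  by have := prime_count_le j; case: prime; lia.
set N := #|S| in cardS.
set P := prime_count y in dens cardS.
have NP : P%:R - 8 <= N%:R :> R by rewrite lerBlDr -natrD ler_nat.
have l6 : 10 ^+ 5 <= l by rewrite /L in Ll; lra.
have l0 : 0 < l by lra.
have PL : 24 / 100 * l <= P%:R by exact: prime_count_ln_ge y0' l0 dens.
have N20 : (20000 <= N)%N by rewrite -(ler_nat R); lra.
(* The pigeonhole exponent is [k.+1]; one factor 2 stays in the radical, so only 2^k is saved. *)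
pose k := (N - N %/ 1000).-1.
have kE : k.+1 = (N - N %/ 1000)%N.
  by rewrite /k prednK// subn_gt0 ltn_Pdiv// (leq_trans _ N20).
have kP : 999 / 1000 * P%:R - 9 <= k%:R :> R.
  have : (999 * N <= 1000 * k.+1)%N.
    by rewrite kE; have := leq_divM N 1000; lia.
  by rewrite -(ler_nat R) !natrM -natr1; lra.
pose K : R := k%:R * ln 2.
have KP : 679 / 1000 * P%:R - 7 <= K.
  have := ln2_gt R => /ltW; rewrite -(ler_pM2l (_ : 0 < k%:R)); last by lra.
  rewrite -/K; lra.
have [KL main lK] := density_estimates y0' l6 dens KP.
exists y, k, S; split; split=> //; rewrite -/l -/K.
- by move=> p; rewrite inE.
- rewrite -/N kE -[X in (_ < 2 ^ X)%N](@subnK (N %/ 1000) N) ?leq_div//.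
  by rewrite expnD ltn_pmul2l ?expn_gt0// -addn1 lt_exp2_div1000.
- by lra.
- by rewrite -/l /L in Ll KL; lra.
Qed.

(** * The inequality for the constructed triples, and their infinitude *)

Lemma Htrunc_lt (R : realType) (m k y b c : nat) :
  let n := ((c - b) * b * c)%N in
  let l : R := ln y%:R in let K : R := k%:R * ln 2 in
  (0 < y)%N -> 1 < l -> 3 * expR 1 < K ->
  67 / 100 * y%:R <= K * (l - 1) -> l < 1004 / 1000 * ln K ->
  (0 < m)%N -> (0 < b < c)%N -> (c <= y ^ m)%N ->
  (2 ^ k.+1 %| c - b)%N -> (2 * m <= omega n)%N -> (8 ^ (2 * m) <= radical n)%N ->
  let h : R := Htrunc R n in h * expR (2 * ln h / ln (ln h)) < c%:R.
Proof.
move=> n l K y0 l1 Ke hK hl m0 /andP[b0 bc] cy dvd om rad.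
set h : R := Htrunc R n; lazy zeta.
have c0 : (0 < c)%N by lia.
have n0 : (0 < n)%N by rewrite !muln_gt0 subn_gt0 bc b0.
have m0' : 0 < m%:R :> R by rewrite ltr0n.
have y0' : 0 < y%:R :> R by rewrite ltr0n.
have c0' : 0 < c%:R :> R by rewrite ltr0n.
have b0' : 0 < b%:R :> R by rewrite ltr0n.
have e2 : 2 <= expR 1 :> R by have := expR_ge1Dx (1 : R); lra.
have l2 := ln2_gt R.
have KE : K = ln (2 ^ k)%N%:R by rewrite natrX lnXn// /K mulr_natl.
have rad0 : (0 < radical n)%N by apply: leq_trans rad; rewrite expn_gt0.
have rad0' : 0 < (radical n)%:R :> R by rewrite ltr0n.
pose G : R := ln (radical n)%:R.
pose v : R := ln c%:R.
have G4 : 4 * m%:R <= G.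
  have : ln (8 ^ (2 * m))%N%:R <= G by rewrite ler_ln ?posrE ?ltr0n ?expn_gt0// ler_nat.
  rewrite natrX lnXn// (_ : 8 = 2 ^+ 3); last by rewrite -natrX.
  rewrite lnXn// -mulrnA -[_ *+ _]mulr_natr !natrM; nra.
have GuvK : G <= ln b%:R + 2 * v - K.
  have := radical_pow_mul_le (isT : (0 < k.+1)%N) n0 (dvdn_mulr c (dvdn_mulr b dvd)).
  have le : (n <= c * b * c)%N by rewrite !leq_mul// leq_subr.
  move=> /leq_trans/(_ le) /=; rewrite -(ler_nat R) !natrM => hle.
  have p0 : 0 < (2 ^ k)%N%:R :> R by rewrite ltr0n expn_gt0.
  have : ln ((2 ^ k)%N%:R * (radical n)%:R) <= ln (c%:R * b%:R * c%:R) :> R.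
    by rewrite ler_ln ?posrE ?mulr_gt0.
  by rewrite !lnM ?posrE ?mulr_gt0// -KE -/v -/G; lra.
have uv : ln b%:R <= v by rewrite ler_ln ?posrE// ler_nat ltnW.
have vml : v <= m%:R * l.
  by rewrite mulr_natl -lnXn// -natrX ler_ln ?posrE ?ler_nat ?ltr0n ?expn_gt0 ?y0.
have Kv : K <= v.
  rewrite KE ler_ln ?posrE ?ltr0n ?expn_gt0// ler_nat.
  apply: leq_trans (leq_subr b c); apply: leq_trans (dvdn_leq _ dvd).
    by rewrite leq_exp2l.
  by rewrite subn_gt0.
have K1 : 1 < K by lra.
have save := log_saving y0' l1 K1 m0' hK hl uv vml Kv G4 GuvK.
set q := m%:R * l in vml save.
have m1 : 1 <= m%:R :> R by rewrite ler1n.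
have lG0 : 0 <= ln G by rewrite ln_ge0//; lra.
have G0 : 0 < G by lra.
have Hpos : 0 < H R n by rewrite divr_gt0 ?exprn_gt0.
have lnH : ln (H R n) <= G - 2 * m%:R * ln G.
  rewrite /H ln_div ?posrE ?exprn_gt0// lnXn// -[_ *+ omega n]mulr_natl lerB// ler_wpM2r//.
  by rewrite -natrM ler_nat.
have cE : c%:R = expR v by rewrite lnK ?posrE.
have h0 : 0 < h by rewrite lt_max expR_gt0 orbT.
rewrite -{1}(lnK (_ : h \in Num.pos)) ?posrE// -expRD cE ltr_expR.
(* If the maximum is e^e, the claim reads 3e < ln c, which the assumption [3 * expR 1 < K]
   ensures. *)
rewrite /h /Htrunc; case: (leP (H R n) (expR (expR 1))) => [_|He].
  by rewrite !expRK divr1; lra.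
have eH : expR 1 < ln (H R n) by rewrite -[ltLHS]expRK ltr_ln ?posrE ?expR_gt0.
have llH : 1 <= ln (ln (H R n)).
  by rewrite -[leLHS]expRK ler_ln ?posrE ?expR_gt0//; lra.
have q0 : 0 < q by lra.
have lq0 : 0 <= ln q by rewrite ln_ge0//; lra.
have lHq : ln (H R n) <= q.
  have : 0 <= 2 * q / ln q by rewrite divr_ge0//; lra.
  lra.
(* As t / ln t is monotone, the saving 2q / ln q is at least the required 2 ln H / ln ln H. *)
have := div_ln_nondecreasing llH (_ : 0 < ln (H R n)) lHq.
move=> /(_ ltac:(lra)); rewrite -!mulrA in save *; lra.
Qed.

Local Open Scope classical_set_scope.

Theorem proposition3 (R : realType) :
  infinite_set [set t : nat * nat * nat |
    let: (a, b, c) := t in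
    [/\ [/\ (0 < a)%N, (0 < b)%N & (0 < c)%N],
        (a + b)%N = c,
        gcdn (gcdn a b) c = 1%N
      & let h : R := Htrunc R (a * b * c)%N in
        h * expR (2 * ln h / ln (ln h)) < c%:R]].
Proof.
move=> /finite_seqP[s sE].
(* [M] bounds c in all listed triples. A new triple has c > k because 2^(k+1) divides c - b, while k
   ln 2 > M and ln 2 <= 1 force k > M. *)
pose M := (\max_(t <- s) t.2)%N.
have [y [k [S [[hS kS y0 l1] [TK hK hl]]]]] :=
  exists_parameters (M%:R + 1 + 3 * expR 1 : R).
have [m [b [c [[m0 /andP[b0 bc] cobc cy] [dvd om rad]]]]] := exists_coprime_pair hS kS.
have M0 : 0 <= M%:R :> R by rewrite ler0n.
have e0 := expR_gt0 (1 : R).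
have Ke : 3 * expR 1 < k%:R * ln 2 :> R by lra.
have bc' : (0 < b < c)%N by rewrite b0.
have main := Htrunc_lt y0 l1 Ke hK hl m0 bc' cy dvd om rad.
have : ((c - b)%N, b, c) \in s.
  suff : [set` s] ((c - b)%N, b, c) by [].
  rewrite -sE /=; split=> //; first by rewrite subn_gt0 bc b0 (leq_trans b0 (ltnW bc)).
    by rewrite subnK// ltnW.
  by rewrite -gcdnA (eqP (cobc : _ == _)) gcdn1.
move=> cs; have cM : (c <= M)%N.
  exact: (@leq_bigmax_seq _ s xpredT (fun t : nat * nat * nat => t.2) _ cs isT).
have kM : (k < M)%N.
  apply: leq_trans cM; apply: leq_trans (leq_subr b c).
  have /leq_trans -> // := ltnW (ltn_expl k.+1 (isT : (1 < 2)%N)).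
  by rewrite dvdn_leq// subn_gt0.
have : M%:R < k%:R :> R.
  have : k%:R * ln 2 <= k%:R :> R.
    by rewrite ler_piMr//; have := @ln_le_sub1 R 2 ltac:(lra); lra.
  lra.
by rewrite ltr_nat ltnNge (ltnW kM).
Qed.
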